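(* Let $A, B \in M_+(n,\mathbb{C})$, $X \in M(n,\mathbb{C})$, and let $m \geq 2$ be an integer. Then $$\left\| \int_0^1 A^{\nu} X B^{1-\nu}\, d\nu \right\|_F \le \frac{1}{m} \left\| \sum_{k=0}^m A^{\frac{k}{m}} X B^{\frac{m-k}{m}} - \frac{1}{2}(AX + XB) \right\|_F \le \frac{1}{m}\left\| \sum_{k=0}^{m-1} A^{\frac{k}{m-1}} X B^{\frac{m-1-k}{m-1}} \right\|_F \leq \frac{1}{2} \left\| AX + XB \right\|_F .$$
   Context: $M(n,\mathbb{C})$ is the set of all $n\times n$ complex matrices and $M_+(n,\mathbb{C})$ is the set of all $n\times n$ positive semidefinite complex matrices. $\|A\|_F = \left(\sum_{i,j=1}^n |a_{ij}|^2\right)^{1/2} = (\mathrm{Tr}[A^*A])^{1/2}$ is the Frobenius (Hilbert-Schmidt) norm. Powers of positive semidefinite matrices are defined by the functional calculus, with $A^0=B^0=I$, and the integral is taken entrywise. *)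

(* Defs.v *)
From HB Require Import structures.
From mathcomp Require Import all_boot all_order all_algebra complex.
From mathcomp Require Import all_classical all_reals all_analysis.

Set Implicit Arguments.
Unset Strict Implicit.
Unset Printing Implicit Defensive.

Import Order.TTheory GRing.Theory Num.Theory.

Local Open Scope ring_scope.
Local Open Scope complex_scope.
Local Open Scope sesquilinear_scope.

Definition frobenius_norm (R : realType) (n : nat) (A : 'M[R[i]]_n) : R :=
  Num.sqrt (\sum_i \sum_j Normc.normc (A i j) ^+ 2).

(* In the order of R[i], 0 <= z means that z is real and nonnegative. *)
Definition psdmx (R : realType) (n : nat) (A : 'M[R[i]]_n) : Prop :=
  A \is hermsymmx /\ forall v : 'cV[R[i]]_n, 0 <= (v ^t* *m A *m v) 0 0.

(* Functional calculus through the diagonalisation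
   A = P^-1 *m diag_mx d *m P with P unitary (orthomx_spectralP); meaningful for
   Hermitian A, where d is real and the result is independent of the choice of
   diagonalisation. *)
Definition mxfun (R : realType) (n : nat) (f : R -> R) (A : 'M[R[i]]_n) :
    'M[R[i]]_n :=
  invmx (spectralmx A)
    *m diag_mx (map_mx (fun z : R[i] => (f (complex.Re z))%:C) (spectral_diag A))
    *m spectralmx A.

(* powR satisfies 0 `^ 0 = 1, hence mxpowR A 0 = 1%:M even for singular A. *)
Definition mxpowR (R : realType) (n : nat) (A : 'M[R[i]]_n) (t : R) :
    'M[R[i]]_n :=
  mxfun (fun x => powR x t) A.

Definition mxintegral01 (R : realType) (n : nat) (F : R -> 'M[R[i]]_n) :
    'M[R[i]]_n :=
  \matrix_(i, j)
    ((\int[lebesgue_measure]_(t in `[0, 1]%classic) complex.Re (F t i j))%R +i*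
     (\int[lebesgue_measure]_(t in `[0, 1]%classic) complex.Im (F t i j))%R).

(* Main.v *)
Require Import Defs.
From mathcomp Require Import all_boot all_order all_algebra complex.
From mathcomp Require Import all_classical all_reals all_analysis.
From mathcomp Require Import measurable_realfun.
From mathcomp Require Import ring lra.

(** Diagonalising A = P^* diag(a) P and B = Q^* diag(b) Q, each matrix in the
    statement has the form P^* (w(a_k, b_l) Y_kl)_kl Q with Y = P X Q^*, where w
    is obtained from f(t) = x^t y^(1-t) by the same linear operation (integral
    over [0, 1], trapezoid sum, grid sum, mean of the endpoint values).  The
    Frobenius norm is unitarily invariant, so it is monotone in w >= 0, and the
    chain of inequalities reduces to the scalar one, which holds for every
    convex f: Hermite-Hadamard on each grid interval gives the first inequality,
    writing k/m as a convex combination of (k-1)/(m-1) and k/(m-1) the second,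
    and the chord of f over [0, 1] the last. *)

Set Implicit Arguments.
Unset Strict Implicit.
Unset Printing Implicit Defensive.

Import Order.TTheory GRing.Theory Num.Theory.
Import numFieldNormedType.Exports.

Local Open Scope ring_scope.
Local Open Scope complex_scope.
Local Open Scope sesquilinear_scope.

Lemma eq_ler (R : numDomainType) (x y : R) : x = y -> x <= y.
Proof. by move->. Qed.

(** * Convex functions on [0, 1]: grid sums and integrals *)

Definition convex01 (R : realType) (f : R -> R) := forall x y t,
  0 <= x <= 1 -> 0 <= y <= 1 -> 0 <= t <= 1 ->
  f (t * x + (1 - t) * y) <= t * f x + (1 - t) * f y.

Section Convex.
Variables (R : realType) (f : R -> R).
Hypothesis fconv : convex01 f.

Let div01 (k p : nat) : (k <= p)%N -> 0 <= (k%:R / p%:R : R) <= 1.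
Proof.
move=> kp; have [->|p0] := posnP p; first by rewrite invr0 mulr0 lexx ler01.
by rewrite divr_ge0//= ler_pdivrMr ?ltr0n// mul1r ler_nat.
Qed.

Lemma sum_natr (p : nat) :
  \sum_(0 <= k < p.+1) (k%:R : R) = p%:R * p.+1%:R / 2.
Proof.
elim: p => [|p IH]; first by rewrite big_nat1 !mul0r.
by rewrite big_nat_recr//= IH -!natr1; field.
Qed.

(** The chord of [f] over [0, 1] dominates [f] at every node, and an affine function averages over
    equally spaced nodes to the mean of its endpoint values. *)
Lemma convex01_sum_le (p : nat) :
  \sum_(0 <= k < p.+2) f (k%:R / p.+1%:R) <= p.+2%:R / 2 * (f 0 + f 1).
Proof.
have p0 : (p.+1%:R : R) != 0 by rewrite pnatr_eq0.
apply: (@le_trans _ _ (\sum_(0 <= k < p.+2)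
    (f 0 + k%:R * ((f 1 - f 0) / p.+1%:R)))).
  apply: ler_sum_nat => k /andP[_ kp].
  have := fconv (x := 1) (y := 0) (t := k%:R / p.+1%:R).
  rewrite !lexx ler01 mulr1 mulr0 addr0.
  move=> /(_ isT isT (@div01 k p.+1 kp)) /le_trans; apply.
  by apply: eq_ler; ring.
rewrite big_split/= sumr_const_nat subn0 -mulr_suml sum_natr.
rewrite -mulr_natr -!natr1 in p0 *.
by apply: eq_ler; field.
Qed.

(* For 0 < k < m, the node k/m is the convex combination of the nodes
   (k-1)/(m-1) and k/(m-1) with weights k/m and 1 - k/m; each interior node of
   the coarser grid is thus used with total weight 1 + 1/m. *)
Lemma convex01_refine (p : nat) :
  \sum_(0 <= k < p.+3) f (k%:R / p.+2%:R) - (f 0 + f 1) / 2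
  <= \sum_(0 <= k < p.+2) f (k%:R / p.+1%:R).
Proof.
have p1 : (p.+1%:R : R) != 0 by rewrite pnatr_eq0.
have p2 : (p.+2%:R : R) != 0 by rewrite pnatr_eq0.
set T := leRHS.
have inner : \sum_(0 <= k < p.+1) f (k.+1%:R / p.+2%:R)
    <= \sum_(0 <= k < p.+1) (k.+1%:R / p.+2%:R * f (k%:R / p.+1%:R)
                          + (1 - k.+1%:R / p.+2%:R) * f (k.+1%:R / p.+1%:R)).
  apply: ler_sum_nat => k /andP[_ kp].
  have := fconv (@div01 k p.+1 (ltnW kp)) (@div01 k.+1 p.+1 kp)
    (@div01 k.+1 p.+2 (leqW kp)).
  set t := k.+1%:R / p.+2%:R.
  rewrite (_ : t * (k%:R / p.+1%:R) + (1 - t) * _ = t)//.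
  by rewrite /t -!natr1 in p1 p2 *; field; rewrite p1 p2.
(* Both sums extend to all nodes of the coarser grid: the first lacks its last term, which is [f 1];
   the second, reindexed, lacks its term at 0, which is [f 0]. *)
have shift : \sum_(0 <= k < p.+1) (k.+1%:R / p.+2%:R * f (k%:R / p.+1%:R)
                          + (1 - k.+1%:R / p.+2%:R) * f (k.+1%:R / p.+1%:R))
    = (1 + p.+2%:R^-1) * T - f 0 - f 1.
  rewrite big_split/= mulrDl mul1r.
  have -> : \sum_(0 <= k < p.+1) (k.+1%:R / p.+2%:R * f (k%:R / p.+1%:R))
      = \sum_(0 <= k < p.+2) (k.+1%:R / p.+2%:R * f (k%:R / p.+1%:R)) - f 1.
    by rewrite [in RHS]big_nat_recr//= !divff// mul1r addrK.
  have -> : \sum_(0 <= k < p.+1) ((1 - k.+1%:R / p.+2%:R) * f (k.+1%:R / p.+1%:R))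
      = \sum_(0 <= k < p.+2) ((1 - k%:R / p.+2%:R) * f (k%:R / p.+1%:R)) - f 0.
    by rewrite [in RHS]big_nat_recl//= !mul0r subr0 mul1r addrC addKr.
  have <- : \sum_(0 <= k < p.+2) (k.+1%:R / p.+2%:R * f (k%:R / p.+1%:R))
      + \sum_(0 <= k < p.+2) ((1 - k%:R / p.+2%:R) * f (k%:R / p.+1%:R))
      = T + p.+2%:R^-1 * T.
    rewrite -big_split/= /T mulr_sumr -big_split/=.
    by apply: eq_bigr => k _; rewrite -natr1; ring.
  by ring.
have -> : \sum_(0 <= k < p.+3) f (k%:R / p.+2%:R)
    = f 0 + f 1 + \sum_(0 <= k < p.+1) f (k.+1%:R / p.+2%:R).
  by rewrite big_nat_recl//= big_nat_recr//= mul0r divff//; ring.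
(* The surplus [T / (p + 2)] is at most the mean of the endpoint values, so the endpoint correction
   absorbs it. *)
have chord : p.+2%:R^-1 * T <= (f 0 + f 1) / 2.
  rewrite mulrC ler_pdivrMr ?ltr0n//; have := convex01_sum_le p; rewrite -/T.
  by move/le_trans; apply; apply: eq_ler; ring.
rewrite shift mulrDl mul1r in inner.
move: inner chord {shift}.
move: T (p.+2%:R^-1 * T) (\sum_(0 <= k < p.+1) _) => T' c I.
lra.
Qed.

Hypothesis fint : (@lebesgue_measure R).-integrable `[0, 1]%classic (EFin \o f).

(** Used to integrate chords; [F] is the antiderivative for the fundamental theorem of calculus. *)
Lemma integral_affine (u v c d : R) : u < v ->
  \int[lebesgue_measure]_(x in `[u, v]) (c + d * x)
  = (v - u) * (c + d * (u + v) / 2).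
Proof.
move=> uv.
pose F (x : R) : R := c * x + d / 2 * (x * x).
have dF (x : R) : is_derive x 1 F (c + d * x).
  rewrite /F; apply: is_derive_eq.
  by rewrite /GRing.scale/=; field.
have cF : continuous F by move=> x; apply/differentiable_continuous/derivable1_diffP.
rewrite /Rintegral (@continuous_FTC2 _ _ F)//=.
- by rewrite /F; field.
- apply: continuous_subspaceT => x.
  by apply: cvgD; [exact: cvg_cst|apply: cvgM; [exact: cvg_cst|exact: cvg_id]].
- split => // [|]; [exact/cvg_at_right_filter/cF|exact/cvg_at_left_filter/cF].
- by move=> x _; rewrite derive1E derive_val.
Qed.

(** The upper Hermite-Hadamard bound: [f] stays below its chord over [u, v], whose integral is the
    area of the trapezoid. *)
Lemma convex01_integral_le (u v : R) : 0 <= u -> u < v -> v <= 1 ->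
  \int[lebesgue_measure]_(x in `[u, v]) f x <= (v - u) * ((f u + f v) / 2).
Proof.
move=> u0 uv v1.
have vu : v - u != 0 by rewrite subr_eq0 gt_eqF.
pose d := (f v - f u) / (v - u).
have -> : (v - u) * ((f u + f v) / 2) =
    \int[lebesgue_measure]_(x in `[u, v]) (f u - d * u + d * x).
  by rewrite integral_affine// /d; field.
apply: le_Rintegral => //.
- apply: integrableS fint => //.
  by apply: subset_itv; rewrite bnd_simp.
- apply: continuous_compact_integrable; first exact: segment_compact.
  apply: continuous_subspaceT => x.
  by apply: cvgD; [exact: cvg_cst|apply: cvgM; [exact: cvg_cst|exact: cvg_id]].
- move=> x /=; rewrite in_itv/= => /andP[ux xv].
  have t01 : 0 <= (x - u) / (v - u) <= 1.
    rewrite divr_ge0 ?subr_ge0 ?(ltW uv)//=.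
    by rewrite ler_pdivrMr ?subr_gt0// mul1r lerD2r.
  have := fconv (x := v) (y := u) _ _ t01.
  rewrite (_ : _ + _ * u = x); last by field.
  rewrite u0 v1 (le_trans u0 (ltW uv)) (le_trans (ltW uv) v1) => /(_ isT isT)/le_trans.
  by apply; apply: eq_ler; rewrite /d; field.
Qed.

Lemma convex01_integral_le_trapezoid (p : nat) :
  \int[lebesgue_measure]_(x in `[0, 1]) f x
  <= p.+1%:R^-1 * (\sum_(0 <= k < p.+2) f (k%:R / p.+1%:R) - (f 0 + f 1) / 2).
Proof.
have p1 : (p.+1%:R : R) != 0 by rewrite pnatr_eq0.
have p1gt : (0 : R) < p.+1%:R by rewrite ltr0n.
(* Induction on the number of grid intervals covered; the halved values sit at the two ends 0 and
   [k / (p + 1)] of the covered part. For [k = 0] both sides vanish. *)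
have H k : (k <= p.+1)%N ->
    \int[lebesgue_measure]_(x in `[0, k%:R / p.+1%:R]) f x
    <= p.+1%:R^-1 * (\sum_(0 <= j < k.+1) f (j%:R / p.+1%:R)
         - (f 0 + f (k%:R / p.+1%:R)) / 2).
  elim: k => [_|k IH kp].
    rewrite big_nat1 mul0r set_itv1 Rintegral_set1.
    by apply: eq_ler; field.
  have /andP[_ k1le] := @div01 k.+1 p.+1 kp.
  have /andP[k0 _] := @div01 k p.+1 (ltnW kp).
  have klt : (k%:R / p.+1%:R : R) < k.+1%:R / p.+1%:R.
    by rewrite ltr_pM2r ?invr_gt0// ltr_nat.
  have fint' : (@lebesgue_measure R).-integrable
      `[0, k.+1%:R / p.+1%:R]%classic (EFin \o f).
    by apply: integrableS fint => //; apply: subset_itv; rewrite bnd_simp.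
  have := @Rintegral_itvB R f (BLeft 0) (BRight (k.+1%:R / p.+1%:R))
    (k%:R / p.+1%:R) fint'.
  rewrite !bnd_simp (ltW klt) => /(_ k0 isT) /eqP.
  rewrite subr_eq => /eqP ->.
  (* The splitting leaves an interval open on the left; closing it adds a null set. *)
  rewrite Rintegral_itv_obnd_cbnd; last first.
    by apply: integrableS fint' => //; apply: subset_itv; rewrite bnd_simp.
  have := convex01_integral_le k0 klt k1le.
  have -> : (k.+1%:R / p.+1%:R - k%:R / p.+1%:R : R) = p.+1%:R^-1.
    by rewrite -mulrBl -[k.+1]addn1 natrD [_ + 1]addrC addrK mul1r.
  move=> step; apply: le_trans (lerD step (IH (ltnW kp))) _.
  rewrite [in leRHS]big_nat_recr//= -mulrDr ler_wpM2l ?invr_ge0 ?ler0n//.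
  move: (\sum_(0 <= j < k.+1) _) => I.
  lra.
by have := H p.+1 (leqnn _); rewrite divff.
Qed.

End Convex.

(** * Convexity and integrability of [t |-> a ^ t b ^ (1 - t)] *)

Lemma powRD_ge0 (R : realType) (a s t : R) : 0 <= s -> 0 <= t ->
  a `^ (s + t) = a `^ s * a `^ t.
Proof.
move=> s0 t0; have [st|st] := eqVneq (s + t) 0; last first.
  by apply: powRD; rewrite (negbTE st).
(* Exponent sum 0 is the delicate case, since at base 0 opposite nonzero exponents violate the law;
   nonnegativity forces both to be 0. *)
have [-> ->] : s = 0 /\ t = 0 by lra.
by rewrite addr0 powRr0 mulr1.
Qed.

(** Young's inequality for [a ^ t] and [b ^ (1 - t)] with conjugate exponents [1 / t] and
    [1 / (1 - t)]; the ends [t = 0] and [t = 1] are treated apart. *)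
Lemma weighted_AMGM (R : realType) (a b t : R) :
  0 <= a -> 0 <= b -> 0 <= t <= 1 ->
  a `^ t * b `^ (1 - t) <= t * a + (1 - t) * b.
Proof.
move=> a0 b0 /andP[t0 t1].
have [->|tn0] := eqVneq t 0.
  by rewrite powRr0 subr0 powRr1// !mul1r mul0r add0r.
have [->|tn1] := eqVneq t 1.
  by rewrite subrr powRr0 powRr1// mulr1 mul1r mul0r addr0.
have tgt : 0 < t by rewrite lt_def tn0.
have s0 : 0 < 1 - t by rewrite subr_gt0 lt_def eq_sym tn1.
have := @conjugate_powR _ (a `^ t) (b `^ (1 - t)) t^-1 (1 - t)^-1.
rewrite !powR_ge0 !invr_gt0 !invrK tgt s0 -!powRrM !divff ?gt_eqF// !powRr1//.
move=> /(_ isT isT isT isT) H.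
rewrite mulrC [t * a]mulrC [(1 - t) * b]mulrC mulrC.
by apply: H; ring.
Qed.

(** The exponents are affine, so the value at a convex combination is the weighted geometric mean of
    the values, to which weighted AM-GM applies. *)
Lemma convex01_powR (R : realType) (a b : R) : 0 <= a -> 0 <= b ->
  convex01 (fun t => a `^ t * b `^ (1 - t)).
Proof.
move=> a0 b0 x y t /andP[x0 x1] /andP[y0 y1] /andP[t0 t1].
have tx : 0 <= t * x by exact: mulr_ge0.
have ty : 0 <= (1 - t) * y by rewrite mulr_ge0// subr_ge0.
have tx' : 0 <= t * (1 - x) by rewrite mulr_ge0// subr_ge0.
have ty' : 0 <= (1 - t) * (1 - y) by rewrite mulr_ge0 ?subr_ge0.
rewrite /= (_ : 1 - (_ + _) = t * (1 - x) + (1 - t) * (1 - y)); last by ring.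
rewrite (powRD_ge0 a tx ty) (powRD_ge0 b tx' ty') mulrACA.
rewrite ![t * _]mulrC ![(1 - t) * _]mulrC !powRrM -!powRM ?powR_ge0//.
rewrite [X in _ <= X + _]mulrC [X in _ <= _ + X]mulrC.
by apply: weighted_AMGM; rewrite ?mulr_ge0 ?powR_ge0// t0.
Qed.

(** If exactly one of [a], [b] is 0, the function jumps at an end of [0, 1]; integrability therefore
    comes from measurability and the bound [a + b], not from continuity. *)
Lemma integrable_powR_mul (R : realType) (a b : R) : 0 <= a -> 0 <= b ->
  (@lebesgue_measure R).-integrable `[0, 1]%classic
    (EFin \o (fun t => a `^ t * b `^ (1 - t))).
Proof.
move=> a0 b0; apply: measurable_bounded_integrable => //.
- by rewrite /= lebesgue_measure_itv/= lte01 -EFinB ltry.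
- apply: measurable_funTS; apply: measurable_funM.
    exact: measurable_powRr.
  apply: (measurableT_comp (measurable_powRr b)).
  by apply: measurable_funB.
- exists (a + b); split; first by rewrite num_real.
  move=> M abM t /=; rewrite in_itv/= => /andP[t0 t1].
  rewrite ger0_norm ?mulr_ge0 ?powR_ge0//.
  apply: le_trans (weighted_AMGM a0 b0 _) _; first by rewrite t0.
  have := mulr_ge0 t0 b0; have : 0 <= (1 - t) * a by rewrite mulr_ge0// subr_ge0.
  lra.
Qed.

(** * Unitary matrices: invariance of the Frobenius norm and diagonalisation *)

Lemma normc_ge0 (K : rcfType) (z : K[i]) : 0 <= Normc.normc z.
Proof. by case: z => x y; exact: sqrtr_ge0. Qed.

Section Frobenius.
Variables (R : realType) (n : nat).
Implicit Types M N U : 'M[R[i]]_n.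

(** In trace form unitary factors cancel: directly for a factor on the right, after a cyclic
    permutation for a factor on the left. *)
Lemma frobenius_norm_trace M :
  ((frobenius_norm M) ^+ 2)%:C = \tr (M *m M ^t*).
Proof.
rewrite sqr_sqrtr; last first.
  by apply: sumr_ge0 => i _; apply: sumr_ge0 => j _; exact: sqr_ge0.
rewrite rmorph_sum; apply: eq_bigr => i _; rewrite rmorph_sum mxE.
by apply: eq_bigr => j _; rewrite !mxE rmorphXn /= -normCK.
Qed.

Lemma frobenius_norm_ge0 M : 0 <= frobenius_norm M.
Proof. exact: sqrtr_ge0. Qed.

Lemma eq_frobenius_norm M N :
  \tr (M *m M ^t*) = \tr (N *m N ^t*) -> frobenius_norm M = frobenius_norm N.
Proof.
rewrite -!frobenius_norm_trace => /complexI /eqP.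
by rewrite eqrXn2 ?frobenius_norm_ge0// => /eqP.
Qed.

Lemma frobenius_norm_unitary_mull U M :
  U \is unitarymx -> frobenius_norm (invmx U *m M) = frobenius_norm M.
Proof.
move=> Uu; apply: eq_frobenius_norm; rewrite invmx_unitary//.
rewrite trmx_mul map_mxM trmxCK mxtrace_mulC.
by rewrite mulmxA mulmxtVK// mxtrace_mulC.
Qed.

Lemma frobenius_norm_unitary_mulr U M :
  U \is unitarymx -> frobenius_norm (M *m U) = frobenius_norm M.
Proof.
move=> Uu; apply: eq_frobenius_norm.
by rewrite trmx_mul map_mxM mulmxA mulmxtVK.
Qed.

End Frobenius.

(** The rows of [spectralmx M] are orthonormal left eigenvectors, so each eigenvalue is a value of
    the quadratic form of [M]; positivity passes to the spectrum this way. *)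
Lemma normalmx_spectral_diag (C : numClosedFieldType) (n : nat) (M : 'M[C]_n)
    (k : 'I_n) (v := row k (spectralmx M)) :
  M \is normalmx -> (v *m M *m v ^t*) 0 0 = spectral_diag M 0 k.
Proof.
move=> /orthomx_spectralP; have Pu := spectral_unitarymx M; rewrite /v.
move: (spectralmx M) (spectral_diag M) Pu => P d Pu ->.
rewrite invmx_unitary// !rowE trmx_mul map_mxM !mulmxA !mulmxtVK//.
rewrite -rowE row_diag_mx -scalemxAl mxE [X in _ * X]mxE.
rewrite (bigD1 k)//= big1 => [|j jk].
  by rewrite !mxE !eqxx /= conjC1 mulr1 addr0 mulr1.
by rewrite !mxE (negbTE jk) conjC0 mulr0.
Qed.

(** * Multiplication by fixed matrices on both sides *)

Section Sandwich.
Variables (K : comPzRingType) (n : nat) (P Q : 'M[K]_n).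
Implicit Types Y Z : 'M[K]_n.

Definition sandwich Y := P *m Y *m Q.

Lemma sandwichD Y Z : sandwich (Y + Z) = sandwich Y + sandwich Z.
Proof. by rewrite /sandwich mulmxDr mulmxDl. Qed.

Lemma sandwichB Y Z : sandwich (Y - Z) = sandwich Y - sandwich Z.
Proof. by rewrite /sandwich mulmxBr mulmxBl. Qed.

Lemma sandwichZ c Y : sandwich (c *: Y) = c *: sandwich Y.
Proof. by rewrite /sandwich -scalemxAr -scalemxAl. Qed.

Lemma sandwich_sum (I : Type) (r : seq I) (p : pred I) (Y : I -> 'M[K]_n) :
  sandwich (\sum_(i <- r | p i) Y i) = \sum_(i <- r | p i) sandwich (Y i).
Proof. by rewrite /sandwich mulmx_sumr mulmx_suml. Qed.

End Sandwich.

Lemma frobenius_norm_sandwich (R : realType) (n : nat) (U V Y : 'M[R[i]]_n) :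
  U \is unitarymx -> V \is unitarymx ->
  frobenius_norm (sandwich (invmx U) V Y) = frobenius_norm Y.
Proof.
move=> Uu Vu.
by rewrite frobenius_norm_unitary_mulr// frobenius_norm_unitary_mull.
Qed.

(** Indexing by pairs gives a single finite sum with coefficients independent of [Y], ready for
    exchange with an integral. *)
Lemma sandwichE (K : comPzRingType) (n : nat) (P Q Y : 'M[K]_n) (i j : 'I_n) :
  sandwich P Q Y i j =
  \sum_(kl : 'I_n * 'I_n) Y kl.1 kl.2 * (P i kl.1 * Q kl.2 j).
Proof.
rewrite mxE -(pair_bigA _ (fun k l => Y k l * (P i k * Q l j)))/= exchange_big/=.
apply: eq_bigr => l _; rewrite mxE mulr_suml; apply: eq_bigr => k _.
by rewrite mulrCA mulrA.
Qed.

Lemma frobenius_normZ (R : realType) (n : nat) (c : R) (M : 'M[R[i]]_n) :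
  0 <= c -> frobenius_norm (c%:C *: M) = c * frobenius_norm M.
Proof.
move=> c0; rewrite -[c in RHS](ger0_norm c0) -sqrtr_sqr -sqrtrM ?sqr_ge0//.
congr Num.sqrt; rewrite mulr_sumr; apply: eq_bigr => k _.
rewrite mulr_sumr; apply: eq_bigr => l _.
rewrite mxE Normc.normcM exprMn; congr (_ * _).
by rewrite /= expr0n/= addr0 sqrtr_sqr real_normK// num_real.
Qed.

(** * Functional calculus of positive semidefinite matrices *)

Section Psd.
Variables (R : realType) (n : nat).
Implicit Types M : 'M[R[i]]_n.

Lemma psdmx_spectral_diag M (k : 'I_n) :
  psdmx M -> 0 <= spectral_diag M 0 k.
Proof.
move=> [Mh Mpos]; rewrite -(normalmx_spectral_diag _ (hermitian_normalmx Mh)).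
by have := Mpos ((row k (spectralmx M)) ^t*); rewrite trmxCK.
Qed.

Lemma psdmx_Re_spectral_diag_ge0 M (k : 'I_n) :
  psdmx M -> 0 <= complex.Re (spectral_diag M 0 k).
Proof.
move=> /(psdmx_spectral_diag k); case: (spectral_diag M 0 k) => x y.
by rewrite lecE => /andP[].
Qed.

(** [mxfun] keeps only real parts of eigenvalues; nothing is lost because here they are real. *)
Lemma psdmx_mxfun_id M : psdmx M -> mxfun id M = M.
Proof.
move=> Mp; have /orthomx_spectralP Md := hermitian_normalmx Mp.1.
rewrite /mxfun [map_mx _ _](_ : _ = spectral_diag M); first exact/esym.
apply/rowP => j; rewrite !mxE; have := psdmx_spectral_diag j Mp.
by case: (spectral_diag M 0 j) => x y; rewrite lecE/= => /andP[/eqP-> _].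
Qed.

Lemma mxfun_cst1 M : mxfun (fun=> 1) M = 1%:M.
Proof.
rewrite /mxfun (_ : map_mx _ _ = const_mx 1).
  by rewrite diag_const_mx mulmx1 mulVmx// unitarymx_unit// spectral_unitarymx.
by apply/rowP => j; rewrite !mxE.
Qed.

End Psd.

(** * Functions of two variables applied to the pair [A], [B] *)

Section DoubleMxfun.
Variables (R : realType) (n : nat) (A B : 'M[R[i]]_n).
Implicit Types (w : R -> R -> R) (X : 'M[R[i]]_n).

Let ev (M : 'M[R[i]]_n) (k : 'I_n) : R := complex.Re (spectral_diag M 0 k).

Definition schur_mult w X : 'M[R[i]]_n :=
  \matrix_(k, l) ((w (ev A k) (ev B l))%:C
     * (spectralmx A *m X *m invmx (spectralmx B)) k l).

(** For Hermitian [A] and [B] this is the finite-dimensional double operator integral with symbol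
    [w]: the sum of [w(a, b) E_a X F_b] over the spectral projections of [A] and [B]. *)
Definition double_mxfun w X : 'M[R[i]]_n :=
  sandwich (invmx (spectralmx A)) (spectralmx B) (schur_mult w X).

Lemma mxfun_mul_double (f g : R -> R) X :
  mxfun f A *m X *m mxfun g B = double_mxfun (fun x y => f x * g y) X.
Proof.
pose d h M := diag_mx (map_mx (fun z : R[i] => (h (complex.Re z))%:C)
                              (spectral_diag M)) : 'M[R[i]]_n.
transitivity (invmx (spectralmx A)
    *m (d f A *m (spectralmx A *m X *m invmx (spectralmx B)) *m d g B)
    *m spectralmx B).
  by rewrite /mxfun !mulmxA.
congr (_ *m _ *m _); apply/matrixP => k l.
by rewrite mul_mx_diag mxE mul_diag_mx !mxE rmorphM/= mulrAC.
Qed.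

Lemma double_mxfunD w1 w2 X :
  double_mxfun w1 X + double_mxfun w2 X
  = double_mxfun (fun x y => w1 x y + w2 x y) X.
Proof.
rewrite -sandwichD; congr sandwich.
by apply/matrixP => k l; rewrite !mxE rmorphD mulrDl.
Qed.

Lemma double_mxfunZ (c : R) w X :
  c%:C *: double_mxfun w X = double_mxfun (fun x y => c * w x y) X.
Proof.
rewrite -sandwichZ; congr sandwich.
by apply/matrixP => k l; rewrite !mxE rmorphM mulrA.
Qed.

Lemma double_mxfunB w1 w2 X :
  double_mxfun w1 X - double_mxfun w2 X
  = double_mxfun (fun x y => w1 x y - w2 x y) X.
Proof.
rewrite -sandwichB; congr sandwich.
by apply/matrixP => k l; rewrite !mxE rmorphB mulrBl.
Qed.

Lemma double_mxfun_sum (I : Type) (r : seq I) (P : pred I)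
    (w : I -> R -> R -> R) X :
  \sum_(i <- r | P i) double_mxfun (w i) X
  = double_mxfun (fun x y => \sum_(i <- r | P i) w i x y) X.
Proof.
rewrite -sandwich_sum; congr sandwich.
apply/matrixP => k l; rewrite summxE mxE rmorph_sum mulr_suml.
by apply: eq_bigr => i _; rewrite mxE.
Qed.

Lemma frobenius_norm_double w X :
  frobenius_norm (double_mxfun w X) = frobenius_norm (schur_mult w X).
Proof.
exact: (frobenius_norm_sandwich _ (spectral_unitarymx A)
  (spectral_unitarymx B)).
Qed.

Hypotheses (hA : psdmx A) (hB : psdmx B).

(** The identity, as the constant function 1 of [B], supplies the missing right factor. *)
Lemma mulmx_double X : A *m X = double_mxfun (fun x _ => x) X.
Proof.
rewrite -{1}(psdmx_mxfun_id hA) -[LHS]mulmx1 -(mxfun_cst1 B) mxfun_mul_double.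
by congr double_mxfun; apply/funext => x; apply/funext => y; rewrite mulr1.
Qed.

Lemma double_mulmx X : X *m B = double_mxfun (fun _ y => y) X.
Proof.
rewrite -{1}(psdmx_mxfun_id hB) -[X in LHS]mul1mx -(mxfun_cst1 A) mxfun_mul_double.
by congr double_mxfun; apply/funext => x; apply/funext => y; rewrite mul1r.
Qed.

(** Unitary invariance removes the outer factors and leaves a comparison of moduli entry by entry;
    the symbols are compared where the eigenvalues lie. *)
Lemma le_frobenius_norm_double w1 w2 X :
  (forall x y, 0 <= x -> 0 <= y -> 0 <= w1 x y <= w2 x y) ->
  frobenius_norm (double_mxfun w1 X) <= frobenius_norm (double_mxfun w2 X).
Proof.
move=> w12; rewrite [leLHS]frobenius_norm_double [leRHS]frobenius_norm_double.
rewrite ler_sqrt; last first.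
  by apply: sumr_ge0 => i _; apply: sumr_ge0 => j _; exact: sqr_ge0.
apply: ler_sum => k _; apply: ler_sum => l _; rewrite !mxE.
have /andP[w0 w1w2] := w12 _ _
  (psdmx_Re_spectral_diag_ge0 k hA) (psdmx_Re_spectral_diag_ge0 l hB).
rewrite lerXn2r ?nnegrE ?normc_ge0//.
rewrite !Normc.normcM ler_wpM2r// ?normc_ge0//.
rewrite /real_complex_def /= expr0n/= !addr0 !sqrtr_sqr.
by rewrite !ger0_norm// (le_trans w0).
Qed.

End DoubleMxfun.

(** * Exchanging the integral with finite sums and with the matrix form *)

Section RintegralSum.
Context d (T : measurableType d) (R : realType) (mu : {measure set T -> \bar R}).
Variables (D : set T) (I : Type) (f : I -> T -> R).
Hypotheses (mD : measurable D) (fint : forall i, mu.-integrable D (EFin \o f i)).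

Lemma integrable_sumr (r : seq I) :
  mu.-integrable D (EFin \o (fun x => \sum_(i <- r) f i x)).
Proof.
rewrite (_ : _ \o _ = (fun x => \sum_(i <- r) (f i x)%:E)%E).
  by apply: integrable_sum => // i _; exact: fint.
by apply/funext => x /=; rewrite sumEFin.
Qed.

Lemma Rintegral_sumr (r : seq I) :
  \int[mu]_(x in D) (\sum_(i <- r) f i x) = \sum_(i <- r) \int[mu]_(x in D) f i x.
Proof.
elim: r => [|i r IH].
  rewrite big_nil; under eq_Rintegral do rewrite big_nil.
  by rewrite Rintegral_cst// mul0r.
rewrite big_cons -IH -RintegralD//; last exact: integrable_sumr.
by apply: eq_Rintegral => x _; rewrite big_cons.
Qed.

End RintegralSum.

Lemma scale_frobenius_norm_double (R : realType) (n : nat) (A B X : 'M[R[i]]_n)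
    (c : R) (w : R -> R -> R) : 0 <= c ->
  c * frobenius_norm (double_mxfun A B w X)
  = frobenius_norm (double_mxfun A B (fun x y => c * w x y) X).
Proof. by move=> c0; rewrite -double_mxfunZ frobenius_normZ. Qed.

(** Each entry is a combination, with coefficients independent of [t], of finitely many integrable
    real functions of [t]. *)
Lemma mxintegral01_double (R : realType) (n : nat) (A B X : 'M[R[i]]_n)
    (w : R -> R -> R -> R) : psdmx A -> psdmx B ->
  (forall x y, 0 <= x -> 0 <= y ->
    (@lebesgue_measure R).-integrable `[0, 1]%classic (EFin \o w x y)) ->
  mxintegral01 (fun t => double_mxfun A B (fun x y => w x y t) X)
  = double_mxfun A B
      (fun x y => \int[lebesgue_measure]_(t in `[0, 1]%classic) w x y t) X.
Proof.
move=> hA hB wint; apply/matrixP => i j; rewrite mxE /double_mxfun.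
pose c (kl : 'I_n * 'I_n) : R[i] :=
  (spectralmx A *m X *m invmx (spectralmx B)) kl.1 kl.2
  * (invmx (spectralmx A) i kl.1 * spectralmx B kl.2 j).
pose v (kl : 'I_n * 'I_n) (h : R -> R -> R) : R :=
  h (complex.Re (spectral_diag A 0 kl.1)) (complex.Re (spectral_diag B 0 kl.2)).
have entry h : sandwich (invmx (spectralmx A)) (spectralmx B) (schur_mult A B h X) i j
    = \sum_kl (v kl h)%:C * c kl.
  by rewrite sandwichE; apply: eq_bigr => kl _; rewrite mxE -mulrA.
have vint kl : (@lebesgue_measure R).-integrable `[0, 1]%classic
    (EFin \o (fun t => v kl (fun x y => w x y t))).
  by apply: wint; apply: psdmx_Re_spectral_diag_ge0.
(* Real and imaginary parts are both additive and real-homogeneous, so one argument serves for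
   both. *)
have linear (phi : {additive R[i] -> R}) :
    (forall (a : R) z, phi (a%:C * z) = a * phi z) ->
    \int[lebesgue_measure]_(t in `[0, 1]%classic)
      phi (\sum_kl (v kl (fun x y => w x y t))%:C * c kl)
    = phi (\sum_kl (v kl (fun x y =>
        \int[lebesgue_measure]_(t in `[0, 1]%classic) w x y t))%:C * c kl).
  move=> phiZ; rewrite raddf_sum.
  under eq_Rintegral do rewrite raddf_sum.
  rewrite Rintegral_sumr//.
    apply: eq_bigr => kl _; rewrite phiZ mulrC -RintegralZl//; last exact: vint.
    by apply: eq_Rintegral => t _; rewrite phiZ mulrC.
  move=> kl; under [X in EFin \o X]eq_fun do rewrite phiZ mulrC.
  exact: (integrableZl _ _ (vint kl)).
under eq_Rintegral do rewrite entry.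
under [X in _ +i* X]eq_Rintegral do rewrite entry.
rewrite entry (linear (@complex.Re R)) ?(linear (@complex.Im R)).
- by case: (\sum_kl _).
- by move=> a [x y]; rewrite /=; ring.
- by move=> a [x y]; rewrite /=; ring.
Qed.

(** * Grid sums and the chain of inequalities *)

Lemma mxpowR_grid_sum (R : realType) (n : nat) (A B X : 'M[R[i]]_n) (p : nat) :
  \sum_(0 <= k < p.+2)
    mxpowR A (k%:R / p.+1%:R) *m X *m mxpowR B ((p.+1 - k)%:R / p.+1%:R)
  = double_mxfun A B (fun x y => \sum_(0 <= k < p.+2)
      x `^ (k%:R / p.+1%:R) * y `^ (1 - k%:R / p.+1%:R)) X.
Proof.
rewrite -double_mxfun_sum; apply: eq_big_nat => k /andP[_ kp].
(* Since [k <= p + 1], the truncated subtraction is exact and the exponent of [B] becomes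
   [1 - k / (p + 1)]. *)
rewrite mxfun_mul_double natrB ?mulrBl ?divff ?pnatr_eq0//.
Qed.

Theorem theorem3p2 (R : realType) (n : nat) (A B X : 'M[R[i]]_n) (m : nat)
    (hA : psdmx A) (hB : psdmx B) (hm : (2 <= m)%N) :
  [/\ frobenius_norm
        (mxintegral01 (fun nu : R => mxpowR A nu *m X *m mxpowR B (1 - nu)))
      <= m%:R^-1 * frobenius_norm
           ((\sum_(0 <= k < m.+1)
               mxpowR A (k%:R / m%:R) *m X *m mxpowR B ((m - k)%:R / m%:R))
            - 2^-1 *: (A *m X + X *m B)),
      m%:R^-1 * frobenius_norm
           ((\sum_(0 <= k < m.+1)
               mxpowR A (k%:R / m%:R) *m X *m mxpowR B ((m - k)%:R / m%:R))
            - 2^-1 *: (A *m X + X *m B))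
      <= m%:R^-1 * frobenius_norm
           (\sum_(0 <= k < m)
               mxpowR A (k%:R / m.-1%:R) *m X
                 *m mxpowR B ((m.-1 - k)%:R / m.-1%:R))
    & m%:R^-1 * frobenius_norm
           (\sum_(0 <= k < m)
               mxpowR A (k%:R / m.-1%:R) *m X
                 *m mxpowR B ((m.-1 - k)%:R / m.-1%:R))
      <= 2^-1 * frobenius_norm (A *m X + X *m B)].
Proof.
(* With [m = p + 2], both grid denominators [m] and [m - 1] are successors, hence nonzero. *)
case: m hm => [|[|p]]// _.
pose f (x y t : R) := x `^ t * y `^ (1 - t).
(* The convention [0 ^ 0 = 1] makes the endpoint values correct for zero eigenvalues too. *)
have f0 x y : 0 <= y -> f x y 0 = y.
  by move=> y0; rewrite /f powRr0 subr0 powRr1// mul1r.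
have f1 x y : 0 <= x -> f x y 1 = x.
  by move=> x0; rewrite /f subrr powRr0 powRr1// mulr1.
have minv0 : 0 <= p.+2%:R^-1 :> R by rewrite invr_ge0.
have hinv0 : 0 <= 2^-1 :> R by rewrite invr_ge0.
have mean : A *m X + X *m B = double_mxfun A B (fun x y => x + y) X.
  by rewrite -double_mxfunD -mulmx_double// -double_mulmx.
have half_mean : 2^-1 *: (A *m X + X *m B)
    = double_mxfun A B (fun x y => 2^-1 * (x + y)) X.
  by rewrite mean -double_mxfunZ fmorphV rmorph_nat.
have path nu : mxpowR A nu *m X *m mxpowR B (1 - nu)
    = double_mxfun A B (fun x y => f x y nu) X.
  exact: mxfun_mul_double.
have integral : mxintegral01 (fun nu : R => mxpowR A nu *m X *m mxpowR B (1 - nu))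
    = double_mxfun A B
        (fun x y => \int[lebesgue_measure]_(t in `[0, 1]%classic) f x y t) X.
  rewrite (_ : (fun nu => _) = fun nu => double_mxfun A B (fun x y => f x y nu) X).
    by apply: mxintegral01_double => // x y x0 y0; exact: integrable_powR_mul.
  by apply/funext => nu; exact: path.
rewrite integral half_mean mean [p.+2.-1]/= (mxpowR_grid_sum A B X p.+1).
rewrite (mxpowR_grid_sum A B X p) double_mxfunB.
have scale := scale_frobenius_norm_double A B X.
have f_ge0 x y t : 0 <= f x y t by rewrite mulr_ge0 ?powR_ge0.
have int_ge0 x y : 0 <= \int[lebesgue_measure]_(t in `[0, 1]%classic) f x y t.
  by apply: Rintegral_ge0.
have int_le x y : 0 <= x -> 0 <= y ->
    \int[lebesgue_measure]_(t in `[0, 1]%classic) f x y t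
    <= p.+2%:R^-1 * (\sum_(0 <= k < p.+3) f x y (k%:R / p.+2%:R) - 2^-1 * (x + y)).
  move=> x0 y0; have := @convex01_integral_le_trapezoid _ _ (convex01_powR x0 y0)
    (integrable_powR_mul x0 y0) p.+1.
  by rewrite -!/(f x y _) f0// f1// [(y + x) / 2]mulrC [y + x]addrC.
split.
- rewrite [leRHS](scale _ _ minv0); apply: le_frobenius_norm_double => // x y x0 y0.
  by rewrite int_ge0 int_le.
- rewrite [leLHS](scale _ _ minv0) [leRHS](scale _ _ minv0).
  apply: le_frobenius_norm_double => // x y x0 y0.
  (* The trapezoid symbol is a difference; it is nonnegative because it dominates the integral. *)
  rewrite (le_trans (int_ge0 x y) (int_le x y x0 y0)) ler_wpM2l//.
  have := @convex01_refine _ _ (convex01_powR x0 y0) p.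
  by rewrite -!/(f x y _) f0// f1// [(y + x) / 2]mulrC [y + x]addrC.
- rewrite [leLHS](scale _ _ minv0) [leRHS](scale _ _ hinv0).
  apply: le_frobenius_norm_double => // x y x0 y0.
  apply/andP; split.
    by rewrite mulr_ge0// sumr_ge0// => k _; exact: (f_ge0 x y (k%:R / p.+1%:R)).
  rewrite mulrC ler_pdivrMr ?ltr0n//.
  have := @convex01_sum_le _ _ (convex01_powR x0 y0) p.
  rewrite -!/(f x y _) f0// f1// => /le_trans; apply.
  by apply: eq_ler; ring.
Qed.
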